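(* For every integer $n\geq 2$, the $n$-dimensional volume of the polytope $$\Pi_n=\{(u_1,\ldots,u_n)\in\mathbf{R}^n : u_i>0,\ u_i+u_{i+1}<\tfrac{\pi}{2}\ (1\le i\le n)\},$$ where indices are taken cyclically so that $u_{n+1}:=u_1$, equals $S(n)=\sum_{k=-\infty}^{\infty}\frac{1}{(4k+1)^n}$.
   Context: For integers $n\ge 2$ the sum $S(n)=\sum_{k\in\mathbf{Z}}(4k+1)^{-n}$ converges absolutely. *)

(* Defs.v *)
From HB Require Import structures.
From mathcomp Require Import all_boot all_order all_algebra.
From mathcomp Require Import all_classical all_reals all_analysis.
Set Implicit Arguments. Unset Strict Implicit. Unset Printing Implicit Defensive.
Import Order.TTheory GRing.Theory Num.Theory.
Import numFieldNormedType.Exports.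
Local Open Scope classical_set_scope.
Local Open Scope ring_scope.

(* Points of R^n are represented as u : nat -> R, only the coordinates
   u 0, ..., u (n-1) being relevant (u i stands for u_{i+1}). *)

(* n-dimensional volume (Lebesgue measure) of a set A of R^n, computed as the
   iterated Lebesgue integral of its indicator function:
   vol n A = \int du_{n-1} ... \int du_0 1_A(u).  For nonnegative measurable
   functions this is the n-dimensional Lebesgue integral (Tonelli). *)
Fixpoint iter_lebesgue_int {R : realType} (n : nat)
    (F : (nat -> R) -> \bar R) : \bar R :=
  match n with
  | 0 => F (fun _ => 0)
  | m.+1 => (\int[@lebesgue_measure R]_x
               iter_lebesgue_int m
                 (fun u => F (fun i => if i == m then x else u i)))%E
  end.

Definition volume {R : realType} (n : nat) (A : set (nat -> R)) : \bar R :=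
  iter_lebesgue_int n (fun u => (\1_A u)%:E).

Definition Pi_poly {R : realType} (n : nat) : set (nat -> R) :=
  [set u | forall i : nat, (i < n)%N ->
      0 < u i /\ u i + u ((i.+1) %% n)%N < pi / 2].

(* S(n) = sum_{k in Z} (4k+1)^{-n}, an absolutely convergent sum for n >= 2;
   Z is enumerated as k = m and k = -m-1 for m : nat. *)
Definition S_term {R : realType} (n : nat) (k : int) : R :=
  ((4 * k + 1)%:~R)^-1 ^+ n.

Definition S_sum {R : realType} (n : nat) : R :=
  limn (fun N : nat =>
    \sum_(0 <= m < N) (S_term n (m%:Z) + S_term n (- (m%:Z) - 1))).

(* Main.v *)
Require Import Defs.
From HB Require Import structures.
From mathcomp Require Import all_boot all_order all_algebra.
From mathcomp Require Import all_classical all_reals all_analysis.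
From mathcomp Require Import measurable_realfun.
From mathcomp Require Import ring lra.
Set Implicit Arguments. Unset Strict Implicit. Unset Printing Implicit Defensive.
Import Order.TTheory GRing.Theory Num.Theory.
Import numFieldNormedType.Exports.
Local Open Scope classical_set_scope.
Local Open Scope ring_scope.

(* With [T f x = \int_0^(pi/2 - x) f], the volume of [Pi_poly n] is the trace of
   [T ^ n].  The functions [cos (l x)], for [l] in [1, -3, 5, -7, ...], are
   eigenfunctions of [T] for the eigenvalues [1 / l].  The kernel of [T ^ 2] is
   [pi / 2 - max u a], and the expansion of [T ^ 2] in eigenfunctions amounts to
     [\sum_(m odd) cos (m x) / m ^ 2 = pi / 4 * (pi / 2 - x)] on [0, pi],
   which is obtained by integrating [\sum_(m odd) sin (m x) / m = pi / 4].
   Integrating the expansion term by term (dominated convergence) gives the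
   kernel of [T ^ n], and integrating that kernel along the diagonal gives the
   sum of the [l ^- n]. *)

(** * Derivative rules and a mean value inequality *)

Lemma is_derive_bigsum {R : realType} (N : nat) (f df : nat -> R -> R) (x : R) :
  (forall j, is_derive x 1 (f j) (df j x)) ->
  is_derive x 1 (fun y => \sum_(j < N) f j y) (\sum_(j < N) df j x).
Proof.
move=> fdf; rewrite [X in is_derive _ _ X _](_ : _ = \sum_(j < N) f j).
  exact: is_derive_sum.
by apply/funext => y; rewrite fct_sumE.
Qed.

Lemma is_derive_continuous {R : realType} (f : R -> R) (x df : R) :
  is_derive x 1 f df -> {for x, continuous f}.
Proof.
by case=> fx _; apply/differentiable_continuous; rewrite -derivable1_diffP.
Qed.

(** Both [g - f] and [g + f] have nonnegative derivatives, hence are nondecreasing by the mean value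
    theorem. This integrates derivative bounds without using integrals. *)
Lemma norm_sub_le_of_derive {R : realType} (f df g dg : R -> R) (a b : R) :
  a <= b ->
  (forall x, a <= x <= b -> is_derive x 1 f (df x)) ->
  (forall x, a <= x <= b -> is_derive x 1 g (dg x)) ->
  (forall x, a <= x <= b -> `|df x| <= dg x) ->
  `|f b - f a| <= g b - g a.
Proof.
move=> ab Df Dg le_dfdg.
have incr (h dh : R -> R) : (forall x, a <= x <= b -> is_derive x 1 h (dh x)) ->
    (forall x, a <= x <= b -> 0 <= dh x) -> 0 <= h b - h a.
  move=> Dh dh_ge0.
  have [||c] := @MVT_segment R h dh a b ab.
  - by move=> x; rewrite in_itv/= => /andP[ax xb]; apply: Dh; rewrite !ltW.
  - apply: continuous_in_subspaceT => x; rewrite inE/= in_itv/= => xab.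
    exact/is_derive_continuous/Dh.
  by rewrite in_itv/= => cab ->; rewrite mulr_ge0 ?subr_ge0// dh_ge0.
have h1 : 0 <= (g - f) b - (g - f) a.
  apply: (incr _ (dg - df)) => x xab.
    by have := Df _ xab; have := Dg _ xab => ? ?; exact: is_deriveB.
  by move: (le_dfdg _ xab); rewrite !fctE ler_norml => /andP[? ?]; lra.
have h2 : 0 <= (g + f) b - (g + f) a.
  apply: (incr _ (dg + df)) => x xab.
    by have := Df _ xab; have := Dg _ xab => ? ?; exact: is_deriveD.
  by move: (le_dfdg _ xab); rewrite !fctE ler_norml => /andP[? ?]; lra.
move: h1 h2; rewrite !fctE => h1 h2.
by rewrite ler_norml; apply/andP; split; lra.
Qed.

Lemma is_derive_mull {R : realType} (c x : R) : is_derive x 1 ( *%R c) c.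
Proof. by have := is_deriveZ c (is_derive_id x 1); rewrite /GRing.scale/= mulr1. Qed.

Lemma is_derive_sinM {R : realType} (c x : R) :
  is_derive x 1 (fun y => sin (c * y)) (c * cos (c * x)).
Proof.
rewrite mulrC; have := is_derive_mull c x => ?.
exact: (@is_derive1_comp _ sin ( *%R c)).
Qed.

Lemma is_derive_cosM {R : realType} (c x : R) :
  is_derive x 1 (fun y => cos (c * y)) (- (c * sin (c * x))).
Proof.
rewrite mulrC -mulNr; have := is_derive_mull c x => ?.
exact: (@is_derive1_comp _ cos ( *%R c)).
Qed.

Lemma is_derive_scale {R : realType} (c : R) (f : R -> R) (x df : R) :
  is_derive x 1 f df -> is_derive x 1 (fun y => c * f y) (c * df).
Proof. exact: is_deriveZ. Qed.

(** * The cosine series over the odd frequencies *)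

Definition oddr {R : realType} (j : nat) : R := (j.*2.+1)%:R.

(* The numbers [4 k + 1], [k] integer, ordered as 1, -3, 5, -7, ... *)
Definition freq {R : realType} (j : nat) : R := (-1) ^+ j * oddr j.

Lemma oddr_gt0 {R : realType} j : 0 < oddr j :> R.
Proof. by rewrite ltr0n. Qed.

Lemma oddr_neq0 {R : realType} j : oddr j != 0 :> R.
Proof. by rewrite gt_eqF ?oddr_gt0. Qed.

Lemma oddrE {R : realType} j : oddr j = 2 * j%:R + 1 :> R.
Proof. by rewrite /oddr -[_.+1%:R]natr1 -muln2 natrM mulrC. Qed.

(** The sum telescopes, as [2 sin x cos ((2 j + 1) x) = sin ((2 j + 2) x) - sin (2 j x)]. It gives
    the derivative of [sine_sum] in closed form. *)
Lemma sum_cos_oddr {R : realType} (N : nat) (x : R) :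
  2 * sin x * \sum_(j < N) cos (oddr j * x) = sin (2 * N%:R * x).
Proof.
elim: N => [|N IH]; first by rewrite big_ord0 !mulr0 mul0r sin0.
rewrite big_ord_recr/= mulrDr IH -[N.+1%:R]natr1.
rewrite (_ : 2 * N%:R * x = oddr N * x - x); last by rewrite oddrE; ring.
rewrite (_ : 2 * (N%:R + 1) * x = oddr N * x + x); last by rewrite oddrE; ring.
by rewrite sinB sinD; ring.
Qed.

Definition leibniz_sum {R : realType} (N : nat) : R :=
  \sum_(j < N) (-1) ^+ j / oddr j.

(** The geometric partial sum differs from [1 / (1 + x ^ 2)] by at most [x ^ (2 N)]. Integrating
    over [[0, 1]] compares the Leibniz sum with [atan 1], with error [1 / (2 N + 1)]. *)
Lemma leibniz_sum_le {R : realType} (N : nat) :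
  `|leibniz_sum N - pi / 4| <= (oddr N)^-1 :> R.
Proof.
pose f (x : R) : R := \sum_(j < N) (-1) ^+ j / oddr j * x ^+ j.*2.+1 - atan x.
pose df (x : R) : R := \sum_(j < N) (-1) ^+ j * x ^+ j.*2 - (1 + x ^+ 2)^-1.
have DX j (x : R) : is_derive x 1 (fun y => y ^+ j.*2.+1) (oddr j * x ^+ j.*2).
  rewrite [X in is_derive _ _ X _](_ : _ = id ^+ j.*2.+1).
    by apply: is_derive_eq; rewrite [_ *: _]mulr1.
  by apply/funext => y; rewrite fctE.
have Df (x : R) : is_derive x 1 f (df x).
  apply: is_deriveB.
  apply: (@is_derive_bigsum _ _ (fun j y => (-1) ^+ j / oddr j * y ^+ j.*2.+1)
    (fun j y => (-1) ^+ j * y ^+ j.*2)) => j.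
  have := is_derive_scale ((-1) ^+ j / oddr j) (DX j x).
  by rewrite mulrA divfK // oddr_neq0.
have := @norm_sub_le_of_derive R f df (fun x => (oddr N)^-1 * x ^+ N.*2.+1)
  (fun x => x ^+ N.*2) 0 1 ler01.
rewrite /f expr0n expr1n atan0 atan1 /= mulr0 mulr1 !subr0.
rewrite [X in _ - X]big1 ?subr0; last by move=> j _; rewrite expr0n mulr0.
under eq_bigr do rewrite expr1n mulr1.
apply => // x /andP[x0 x1].
- have := is_derive_scale (oddr N)^-1 (DX N x).
  by rewrite mulrA mulVf ?mul1r// oddr_neq0.
- have x2 : 0 < 1 + x ^+ 2 by rewrite ltr_pwDl // sqr_ge0.
  have -> : df x = - ((- x ^+ 2) ^+ N / (1 + x ^+ 2)).
    rewrite /df; under eq_bigr do rewrite -muln2 mulnC exprM -exprMn mulN1r.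
    elim: N {f df Df} => [|N IH]; first by rewrite big_ord0 expr0 sub0r mul1r.
    rewrite big_ord_recr/= addrAC IH [_ ^+ N.+1]exprSr.
    by move: ((- x ^+ 2) ^+ N) => z; field; lra.
  rewrite normrN normrM normrX normrN !ger0_norm ?sqr_ge0 ?invr_ge0 ?(ltW x2)//.
  by rewrite -muln2 mulnC exprM ler_piMr ?exprn_ge0// invf_le1// lerDl sqr_ge0.
Qed.

Lemma sin_oddr_pihalf {R : realType} j : sin (oddr j * (pi / 2)) = (-1) ^+ j :> R.
Proof.
elim: j => [|j IH]; first by rewrite mul1r sin_pihalf.
rewrite (_ : oddr j.+1 * _ = oddr j * (pi / 2) + pi); last first.
  by rewrite !oddrE -[j.+1%:R]natr1; field.
by rewrite sinDpi IH exprS mulN1r.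
Qed.

(** The alternating sign in [freq] makes this value 1 for every [j]; that is why the eigenvalues are
    the inverses of the numbers [4 k + 1], with their signs. *)
Lemma sin_freq_pihalf {R : realType} j : sin (freq j * (pi / 2)) = 1 :> R.
Proof.
have -> : sin (freq j * (pi / 2)) = (-1) ^+ j * sin (oddr j * (pi / 2)) :> R.
  rewrite /freq -signr_odd; case: odd; last by rewrite expr0 !mul1r.
  by rewrite expr1 !mulNr !mul1r sinN.
by rewrite sin_oddr_pihalf -expr2 sqrr_sign.
Qed.

Lemma cos_freq_pihalf {R : realType} j : cos (freq j * (pi / 2)) = 0 :> R.
Proof. by apply: sin1cos0; rewrite sin_freq_pihalf normr1. Qed.

Lemma cos_freq {R : realType} j (x : R) : cos (freq j * x) = cos (oddr j * x).
Proof.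
rewrite /freq -signr_odd; case: odd; last by rewrite expr0 mul1r.
by rewrite expr1 !mulNr mul1r cosN.
Qed.

Lemma freq_sqr {R : realType} j : freq j ^+ 2 = oddr j ^+ 2 :> R.
Proof. by rewrite exprMn sqrr_sign mul1r. Qed.

Lemma freq_neq0 {R : realType} j : freq j != 0 :> R.
Proof. by rewrite -sqrf_eq0 freq_sqr sqrf_eq0 oddr_neq0. Qed.

Definition sine_sum {R : realType} (N : nat) (x : R) : R :=
  \sum_(j < N) sin (oddr j * x) / oddr j.

Definition cosine_sum {R : realType} (N : nat) (x : R) : R :=
  \sum_(j < N) cos (oddr j * x) / oddr j ^+ 2.

Lemma is_derive_sine_sum {R : realType} N (x : R) :
  is_derive x 1 (sine_sum N) (\sum_(j < N) cos (oddr j * x)).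
Proof.
apply: (@is_derive_bigsum _ _ (fun j y => sin (oddr j * y) / oddr j)
    (fun j y => cos (oddr j * y))) => j.
have := is_derive_scale (oddr j)^-1 (is_derive_sinM (oddr j) x).
rewrite mulrA mulVf ?mul1r ?oddr_neq0//.
by under [X in is_derive _ _ X _]funext do rewrite mulrC.
Qed.

Lemma is_derive_cosine_sum {R : realType} N (x : R) :
  is_derive x 1 (cosine_sum N) (- sine_sum N x).
Proof.
rewrite /sine_sum -sumrN.
apply: (@is_derive_bigsum _ _ (fun j y => cos (oddr j * y) / oddr j ^+ 2)
    (fun j y => - (sin (oddr j * y) / oddr j))) => j.
have := is_derive_scale (oddr j ^+ 2)^-1 (is_derive_cosM (oddr j) x).
rewrite (_ : _ * - _ = - (sin (oddr j * x) / oddr j)).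
  by under [X in is_derive _ _ X _]funext do rewrite mulrC.
by have := @oddr_neq0 R j; move: (oddr j) => m m0; field.
Qed.

(* Adding [cos (2 N x) / (4 N sin x)] to [sine_sum N] cancels the leading part
   [sin (2 N x) / (2 sin x)] of the derivative (integration by parts). *)
Lemma sine_sum_le {R : realType} N (x : R) : (0 < N)%N -> 0 < x <= pi / 2 ->
  `|sine_sum N x - leibniz_sum N| <= (2 * N%:R * sin x)^-1.
Proof.
move=> N0 /andP[x0 xpi].
have n0 : 0 < N%:R :> R by rewrite ltr0n.
pose c : R := (4 * N%:R)^-1.
have c0 : 0 < c by rewrite invr_gt0 mulr_gt0.
have sin0 y : x <= y <= pi / 2 -> 0 < sin y.
  move=> /andP[xy ypi]; apply: sin_gt0_pi; rewrite (lt_le_trans x0 xy)/=.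
  by have := @pi_gt0 R; lra.
have D1 (y : R) : x <= y <= pi / 2 ->
    is_derive y 1 (fun z => (sin z)^-1) (- (cos y / sin y ^+ 2)).
  move=> /sin0 sy; have := is_deriveV (lt0r_neq0 sy) (is_derive_sin y).
  by rewrite [_ *: _]mulNr mulrC.
pose f (y : R) := sine_sum N y + c * (cos (2 * N%:R * y) * (sin y)^-1).
pose df (y : R) := - c * (cos (2 * N%:R * y) * (cos y / sin y ^+ 2)).
have Df (y : R) : x <= y <= pi / 2 -> is_derive y 1 f (df y).
  move=> yx; have sy := sin0 _ yx.
  have := is_deriveD (is_derive_sine_sum N y)
    (is_derive_scale c (is_deriveM (is_derive_cosM (2 * N%:R) y) (D1 _ yx))).
  move=> /is_derive_eq; apply.
  rewrite /df /c /GRing.scale/= -sum_cos_oddr; move: (\sum_(_ < _) _) => s.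
  by field; rewrite !lt0r_neq0.
(* Bounding [cos (2 N y)] by 1 in [df] leaves exactly the derivative of [- c / sin y]. *)
have := @norm_sub_le_of_derive R f df (fun y => - c * (sin y)^-1)
  (fun y => c * (cos y / sin y ^+ 2)) x (pi / 2) xpi Df.
have -> : f (pi / 2) = leibniz_sum N + c * cos (N%:R * pi).
  rewrite /f sin_pihalf invr1 mulr1; congr (_ + c * cos _); last by field.
  by apply: eq_bigr => j _; rewrite sin_oddr_pihalf.
rewrite sin_pihalf invr1 mulr1 => /(_ _ _)/wrap[||].
- move=> y yx; have := is_derive_scale (- c) (D1 _ yx).
  by rewrite mulrN mulNr opprK.
- move=> y yx; have sy := sin0 _ yx.
  rewrite /df normrM normrN (gtr0_norm c0) ler_wpM2l ?(ltW c0)// normrM.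
  have cy : 0 <= cos y.
    by apply: cos_ge0_pihalf; move: yx => /andP[? ?]; apply/andP; split; lra.
  rewrite [X in _ * X]ger0_norm ?divr_ge0 ?sqr_ge0//.
  by rewrite ler_piMl ?divr_ge0 ?sqr_ge0// cos_max.
rewrite /f.
have sx : 0 < (sin x)^-1 by rewrite invr_gt0 sin0// lexx.
(* The comparison contributes [c / sin x - c], the correction terms at most [c] at [pi / 2] and
   [c / sin x] at [x]: in total [2 c / sin x]. *)
have -> : (2 * N%:R * sin x)^-1 = 2 * (c * (sin x)^-1).
  by rewrite /c; field; rewrite !lt0r_neq0// -invr_gt0.
have h1 : `|c * cos (N%:R * pi)| <= c.
  by rewrite normrM gtr0_norm// ler_piMr ?(ltW c0)// cos_max.
have h2 : `|c * (cos (2 * N%:R * x) * (sin x)^-1)| <= c * (sin x)^-1.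
  rewrite normrM gtr0_norm// ler_wpM2l ?(ltW c0)// normrM (gtr0_norm sx).
  by rewrite ler_piMl ?(ltW sx)// cos_max.
move: h1 h2; rewrite !ler_norml => /andP[? ?] /andP[? ?] /andP[? ?].
by apply/andP; split; lra.
Qed.

(** Integrate the bound on [sine_sum] from [x] to [pi / 2], where [cosine_sum] vanishes. Since [sin]
    increases there, the bound at [x] serves on the whole interval. *)
Lemma cosine_sum_near {R : realType} N (x : R) : (0 < N)%N -> 0 < x <= pi / 2 ->
  `|cosine_sum N x - leibniz_sum N * (pi / 2 - x)|
    <= (2 * N%:R * sin x)^-1 * (pi / 2 - x).
Proof.
move=> N0 /andP[x0 xpi]; set C := (2 * N%:R * sin x)^-1.
have pi0 := @pi_gt0 R.
have n0 : 0 < N%:R :> R by rewrite ltr0n.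
pose f (y : R) := cosine_sum N y + leibniz_sum N * y.
have := @norm_sub_le_of_derive R f (fun y => - sine_sum N y + leibniz_sum N)
  ( *%R C) (fun=> C) x (pi / 2) xpi => /(_ _ _ _)/wrap[|||].
- move=> y _; apply: is_deriveD; first exact: is_derive_cosine_sum.
  exact: is_derive_mull.
- by move=> y _; exact: is_derive_mull.
- move=> y /andP[xy ypi]; rewrite addrC -normrN opprB.
  apply: (le_trans (sine_sum_le _ _)) => //; first by rewrite (lt_le_trans x0 xy).
  have sx : 0 < sin x by apply: sin_gt0_pi; rewrite x0/=; lra.
  have sxy : sin x <= sin y.
    move: xy; rewrite le_eqVlt => /predU1P[->//|xy].
    by rewrite ltW// ltr_sin// in_itv/=; apply/andP; split; lra.
  have sy := lt_le_trans sx sxy; rewrite lef_pV2 ?posrE ?mulr_gt0//.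
  by rewrite ler_wpM2l// mulr_ge0 ?ltW.
rewrite /f.
have -> : cosine_sum N (pi / 2 : R) = 0.
  rewrite /cosine_sum big1// => j _.
  by rewrite -cos_freq cos_freq_pihalf mul0r.
rewrite !ler_norml => /andP[? ?]; apply/andP; split; lra.
Qed.

(** Since [1 / (2 x + 1) ^ 2 <= 1 / (4 x (x + 1)) = 1 / (4 x) - 1 / (4 (x + 1))], the tail is
    dominated by a telescoping sum. *)
Lemma sum_oddr_tail_le {R : realType} (c : nat -> R) (N k : nat) : (0 < N)%N ->
  (forall j, `|c j| <= (oddr j ^+ 2)^-1) ->
  `|\sum_(j < N + k) c j - \sum_(j < N) c j| <= (4 * N%:R)^-1.
Proof.
move=> N0 c_le.
have gt0 m : 0 < (N + m)%:R :> R by rewrite ltr0n addn_gt0 N0.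
apply: (@le_trans _ _ ((4 * N%:R)^-1 - (4 * (N + k)%:R)^-1)); last first.
  by rewrite gerBl invr_ge0 mulr_ge0// ltW.
elim: k => [|k IH]; first by rewrite addn0 !subrr normr0.
rewrite addnS big_ord_recr/= addrAC (le_trans (ler_normD _ _))//.
apply: (le_trans (lerD IH (c_le _))).
have := gt0 k; rewrite oddrE -[(N + k).+1%:R]natr1; move: ((N + k)%:R) => x x0.
have -> : (4 * N%:R)^-1 - (4 * (x + 1))^-1 = (4 * N%:R)^-1 - (4 * x)^-1 +
    (4 * x * (x + 1))^-1.
  by have := gt0 0%N; rewrite addn0 => n0; field; rewrite !lt0r_neq0//; lra.
rewrite lerD2l lef_pV2 ?posrE; last 2 first.
- by rewrite exprn_gt0//; lra.
- by rewrite !mulr_gt0//; lra.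
by nra.
Qed.

Lemma cosine_sum_tail_le {R : realType} N k (x : R) : (0 < N)%N ->
  `|cosine_sum (N + k) x - cosine_sum N x| <= (4 * N%:R)^-1.
Proof.
move=> N0; apply: (@sum_oddr_tail_le _
  (fun j => cos (oddr j * x) / oddr j ^+ 2)) => // j.
have h : 0 <= (oddr j ^+ 2)^-1 :> R by rewrite invr_ge0 sqr_ge0.
by rewrite normrM (ger0_norm h) ler_piMl// cos_max.
Qed.

Lemma cvg_of_dist_le_divn {R : realType} (u : nat -> R) (l C : R) :
  (forall N, (0 < N)%N -> `|u N - l| <= C / N%:R) -> u N @[N --> \oo] --> l.
Proof.
move=> u_le; apply/cvgrPdist_le => e e0.
exists (Num.truncn (C / e)).+1 => // N /= leN.
have N0 : (0 < N)%N by apply: leq_trans leN.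
rewrite distrC (le_trans (u_le _ N0))// ler_pdivrMr ?ltr0n// mulrC.
by rewrite -ler_pdivrMr// ltW// (lt_le_trans (truncnS_gt _))// ler_nat.
Qed.

Lemma cosine_sum_half_cvg {R : realType} (x : R) : 0 < x <= pi / 2 ->
  cosine_sum N x @[N --> \oo] --> pi / 4 * (pi / 2 - x).
Proof.
move=> xpi; have pi0 := @pi_gt0 R.
have sx : 0 < sin x.
  by apply: sin_gt0_pi; move: xpi => /andP[x0 xpi]; rewrite x0/=; lra.
apply: (@cvg_of_dist_le_divn _ _ _ (((sin x)^-1 + 1) * (pi / 2 - x))) => N N0.
have n0 : 0 < N%:R :> R by rewrite ltr0n.
have y0 : 0 <= pi / 2 - x by move: xpi; lra.
(* The error splits into the distance to the partial Leibniz line and the error of the Leibniz sum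
   itself. *)
rewrite (_ : _ - _ = (cosine_sum N x - leibniz_sum N * (pi / 2 - x)) +
  (leibniz_sum N - pi / 4) * (pi / 2 - x)); last by ring.
apply: (le_trans (ler_normD _ _)).
apply: (le_trans (lerD (cosine_sum_near N0 xpi) (lexx _))).
rewrite normrM (ger0_norm y0) -mulrDl [leRHS]mulrAC ler_wpM2r//.
rewrite [leRHS]mulrDl mul1r lerD//.
  rewrite -invfM lef_pV2 ?posrE ?mulr_gt0//.
  by rewrite mulrC ler_wpM2r ?(ltW sx)// ler_peMl ?(ltW n0)// ler1n.
apply: (le_trans (leibniz_sum_le _)).
rewrite lef_pV2 ?posrE ?oddr_gt0// oddrE; lra.
Qed.

(** The rate obtained so far degenerates as [x] tends to 0, but it identifies the limit. The tail
    estimate, uniform in [x], then gives a uniform rate. *)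
Lemma cosine_sum_half_le {R : realType} N (x : R) : (0 < N)%N -> 0 < x <= pi / 2 ->
  `|cosine_sum N x - pi / 4 * (pi / 2 - x)| <= (4 * N%:R)^-1.
Proof.
move=> N0 /cosine_sum_half_cvg cx.
apply/ler_addgt0Pr => e e0.
have /cvgrPdist_le /(_ e e0)[M _ leM] := cx.
have := leM (N + M)%N (leq_addl _ _); have := cosine_sum_tail_le M x N0.
rewrite !ler_norml => /andP[? ?] /andP[? ?]; apply/andP; split; lra.
Qed.

Lemma cosine_sumN {R : realType} N (x : R) : cosine_sum N (pi - x) = - cosine_sum N x.
Proof.
rewrite /cosine_sum -sumrN; apply: eq_bigr => j _.
rewrite -mulNr; congr (_ / _).
have -> : oddr j * (pi - x) = oddr j * (pi / 2) + oddr j * (pi / 2) - oddr j * x.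
  by field.
rewrite cosB cosD sinD -!(cos_freq j) cos_freq_pihalf sin_oddr_pihalf.
by rewrite -[_ ^+ j * _]expr2 sqrr_sign; ring.
Qed.

(** The reflection [x -> pi - x] changes the sign of both terms, which reduces to [x <= pi / 2]. The
    endpoint 0 matters: it is the value of [u - a] on the diagonal. *)
Lemma cosine_sum_le {R : realType} N (x : R) : (0 < N)%N -> 0 <= x <= pi ->
  `|cosine_sum N x - pi / 4 * (pi / 2 - x)| <= (4 * N%:R)^-1.
Proof.
move=> N0; have pi0 := @pi_gt0 R.
wlog xpi : x / x <= pi / 2 => [wl|] /andP[x0 xpi'].
  have [/wl|xpi] := leP x (pi / 2); first by apply; rewrite x0.
  have := wl (pi - x); rewrite cosine_sumN -normrN => h.
  rewrite [X in `|X|](_ : _ = - (- cosine_sum N x - pi / 4 * (pi / 2 - (pi - x)))).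
    by apply: h; [lra | apply/andP; split; lra].
  by field.
move: x0; rewrite le_eqVlt => /predU1P[<-{x xpi xpi'}|x0]; last first.
  by apply: cosine_sum_half_le => //; rewrite x0.
(* at [0], let [x] tend to [0] in the previous case with [N] fixed *)
pose h (x : R) := `|cosine_sum N x - pi / 4 * (pi / 2 - x)|.
have ch : h x @[x --> 0^'+] --> h 0.
  apply: cvg_at_right_filter; apply: cvg_norm; apply: cvgB.
    exact/is_derive_continuous/is_derive_cosine_sum.
  by apply: cvgM; [exact: cvg_cst | apply: cvgB; [exact: cvg_cst | exact: cvg_id]].
apply: (cvgr_to_le ch).
near=> x; apply: cosine_sum_half_le => //; apply/andP; split => //.
near: x; apply: nbhs_right_le; lra.
Unshelve. all: by end_near. Qed.

Lemma cosine_sum_cvg {R : realType} (x : R) : 0 <= x <= pi ->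
  cosine_sum N x @[N --> \oo] --> pi / 4 * (pi / 2 - x).
Proof.
move=> x0pi; apply: (@cvg_of_dist_le_divn _ _ _ 4^-1) => N N0.
by rewrite -invfM cosine_sum_le.
Qed.

(** * Eigenfunction expansion of the iterated kernels *)

(* Partial sums of the eigenfunction expansion of the [n]-th iterate of the
   integral operator with kernel [1_{u + a < pi / 2}]. *)
Definition kernel_sum {R : realType} (n N : nat) (u a : R) : R :=
  4 / pi * \sum_(j < N) cos (freq j * u) * cos (freq j * a) / freq j ^+ n.

Lemma kernel_sumC {R : realType} n N (u a : R) :
  kernel_sum n N u a = kernel_sum n N a u.
Proof. by congr (_ * _); apply: eq_bigr => j _; rewrite [cos _ * _]mulrC. Qed.

(** Product-to-sum formula for the cosines; the signs of the frequencies disappear in the even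
    power. *)
Lemma kernel_sum2E {R : realType} N (u a : R) :
  kernel_sum 2 N u a = 2 / pi * (cosine_sum N (u + a) + cosine_sum N (u - a)).
Proof.
rewrite /kernel_sum /cosine_sum -big_split/= !mulr_sumr; apply: eq_bigr => j _.
rewrite !cos_freq freq_sqr [_ * (u + a)]mulrDr [_ * (u - a)]mulrBr cosB cosD.
have := @oddr_neq0 R j; have := lt0r_neq0 (@pi_gt0 R).
by move: (pi : R) (oddr j) => p m p0 m0; field; rewrite m0.
Qed.

Lemma kernel_sum2_cvg {R : realType} (u a : R) :
  0 <= u <= pi / 2 -> 0 <= a <= pi / 2 ->
  kernel_sum 2 N u a @[N --> \oo] --> pi / 2 - Num.max u a.
Proof.
wlog au : u a / a <= u => [wl u_itv a_itv|/andP[u0 upi] /andP[a0 api]].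
  case/orP: (le_total a u) => [au|ua]; first exact: wl.
  under eq_fun do rewrite kernel_sumC.
  by rewrite maxC; exact: wl.
have pi0 := @pi_gt0 R.
rewrite (max_l au).
(* The variable [a] cancels between the limits at [u + a] and [u - a]; both points lie in [[0, pi]]
   because [a <= u]. *)
rewrite (_ : pi / 2 - u = 2 / pi * (pi / 4 * (pi / 2 - (u + a)) +
  pi / 4 * (pi / 2 - (u - a)))); last first.
  by have := lt0r_neq0 pi0; move: (pi : R) => p p0; field.
under eq_fun do rewrite kernel_sum2E.
apply: cvgM; [exact: cvg_cst|apply: cvgD]; apply: cosine_sum_cvg;
  apply/andP; split; lra.
Qed.

(** Provides the dominating constant, independent of [N], [u] and [a], for every passage to the
    limit under an integral. *)
Lemma kernel_sum_le {R : realType} n N (u a : R) : (2 <= n)%N ->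
  `|kernel_sum n N u a| <= 8 / pi.
Proof.
move=> n2; have pi0 := @pi_gt0 R.
rewrite /kernel_sum normrM ger0_norm ?divr_ge0 ?(ltW pi0)//.
rewrite (_ : 8 / pi = 4 / pi * 2); last first.
  by have := lt0r_neq0 pi0; move: (pi : R) => p p0; field.
rewrite ler_wpM2l ?divr_ge0 ?(ltW pi0)//.
pose c j : R := cos (freq j * u) * cos (freq j * a) / freq j ^+ n.
have c_le j : `|c j| <= (oddr j ^+ 2)^-1.
  rewrite /c !normrM -[leRHS]mul1r ler_pM ?mulr_ge0//.
    by rewrite mulr_ile1 ?cos_max.
  rewrite normfV normrX normrM normrX normrN1 expr1n mul1r.
  rewrite (gtr0_norm (oddr_gt0 _)) lef_pV2 ?posrE ?exprn_gt0 ?oddr_gt0//.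
  by rewrite ler_weXn2l// ler1n.
case: N => [|N]; first by rewrite big_ord0 normr0.
(* The first term is at most 1 and the tail after it at most [1 / 4], so the sum stays below 2. *)
have := @sum_oddr_tail_le _ c 1 N isT c_le; have := c_le 0%N.
rewrite add1n [\sum_(j < 1) _]big_ord1 /= expr1n invr1 mulr1.
rewrite !ler_norml => /andP[? ?] /andP[? ?].
have : (4 : R)^-1 <= 1 by rewrite invf_le1// ler1n.
by move=> ?; apply/andP; split; lra.
Qed.

Lemma is_derive_kernel_sum {R : realType} n N (a x : R) :
  is_derive x 1 (fun y => 4 / pi *
      \sum_(j < N) sin (freq j * y) * cos (freq j * a) / freq j ^+ n.+1)
    (kernel_sum n N x a).
Proof.
apply: is_derive_scale.
apply: (@is_derive_bigsum _ _
    (fun j y => sin (freq j * y) * cos (freq j * a) / freq j ^+ n.+1)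
    (fun j y => cos (freq j * y) * cos (freq j * a) / freq j ^+ n)) => j.
have := is_derive_scale (cos (freq j * a) / freq j ^+ n.+1)
  (is_derive_sinM (freq j) x).
rewrite (_ : _ / _ * _ = cos (freq j * x) * cos (freq j * a) / freq j ^+ n).
  by congr (is_derive _ _ _ _); apply/funext => y; rewrite mulrC mulrA.
by rewrite exprS; field; rewrite expf_neq0 ?freq_neq0.
Qed.

Lemma continuous_bigsum {R : realType} N (f : nat -> R -> R) :
  (forall j, continuous (f j)) -> continuous (fun x => \sum_(j < N) f j x).
Proof.
move=> cf; elim: N => [|N IH] x.
  by under eq_fun do rewrite big_ord0; exact: cvg_cst.
rewrite (_ : (fun x => _) = (fun x => \sum_(j < N) f j x) \+ f N).
  by apply: cvgD; [exact: IH|exact: cf].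
by apply/funext => y; rewrite big_ord_recr.
Qed.

Lemma continuous_cosM {R : realType} (c : R) : continuous (fun x => cos (c * x)).
Proof. by move=> x; exact: is_derive_continuous (is_derive_cosM c x). Qed.

Lemma continuous_kernel_sum {R : realType} n N (a : R) :
  continuous (fun x => kernel_sum n N x a).
Proof.
move=> x; apply: cvgM; first exact: cvg_cst.
apply: (@continuous_bigsum _ _
  (fun j x => cos (freq j * x) * cos (freq j * a) / freq j ^+ n)) => j y.
apply: cvgM; last exact: cvg_cst.
by apply: cvgM; [exact: continuous_cosM|exact: cvg_cst].
Qed.

(** Termwise primitive of [cos ^ 2], from [cos t ^ 2 = (1 + cos (2 t)) / 2]. *)
Lemma is_derive_kernel_sum_diag {R : realType} n N (x : R) :
  is_derive x 1 (fun y => 4 / pi * \sum_(j < N)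
     (y / 2 + sin (2 * freq j * y) / (4 * freq j)) / freq j ^+ n)
    (kernel_sum n N x x).
Proof.
apply: is_derive_scale.
apply: (@is_derive_bigsum _ _
    (fun j y => (y / 2 + sin (2 * freq j * y) / (4 * freq j)) / freq j ^+ n)
    (fun j y => cos (freq j * y) * cos (freq j * y) / freq j ^+ n)) => j.
have := is_derive_scale (freq j ^+ n)^-1 (is_deriveD (is_derive_mull 2^-1 x)
  (is_derive_scale (4 * freq j)^-1 (is_derive_sinM (2 * freq j) x))).
rewrite (_ : _^-1 * (_ + _) = cos (freq j * x) * cos (freq j * x) / freq j ^+ n).
  congr (is_derive _ _ _ _).
  by apply/funext => y; rewrite fctE mulrC [y / _]mulrC [sin _ / _]mulrC.
have -> : 2 * freq j * x = (freq j * x) *+ 2 by rewrite mulr2n; ring.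
rewrite cos_mulr2n mulr2n.
by field; rewrite expf_neq0 ?freq_neq0.
Qed.

Lemma continuous_kernel_sum_diag {R : realType} n N :
  continuous (fun x : R => kernel_sum n N x x).
Proof.
move=> x; apply: cvgM; first exact: cvg_cst.
apply: (@continuous_bigsum _ _
  (fun j x => cos (freq j * x) * cos (freq j * x) / freq j ^+ n)) => j y.
apply: cvgM; last exact: cvg_cst.
by apply: cvgM; exact: continuous_cosM.
Qed.

(** * Integrals of the partial sums and dominated convergence *)

Lemma integral_oo_derive {R : realType} (F f : R -> R) (a b : R) : a <= b ->
  (forall x : R, is_derive x 1 F (f x)) -> continuous f ->
  (\int[lebesgue_measure]_(x in `]a, b[) (f x)%:E = (F b - F a)%:E)%E.
Proof.
move=> ab DF cf.
have mf D : measurable_fun D f.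
  exact: measurable_funS (continuous_measurable_fun cf).
move: ab; rewrite le_eqVlt => /predU1P[<-|ab].
  by rewrite set_itvoo0 integral_set0 subrr.
rewrite integral_itv_bndo_bndc; last exact/measurable_EFinP.
rewrite integral_itv_obnd_cbnd; last exact/measurable_EFinP.
rewrite (@continuous_FTC2 _ f F)//.
- exact: continuous_subspaceT.
- split.
  + by move=> x _; case: (DF x).
  + exact/cvg_at_right_filter/(is_derive_continuous (DF a)).
  + exact/cvg_at_left_filter/(is_derive_continuous (DF b)).
- by move=> x _; rewrite derive1E; case: (DF x).
Qed.

(** This is the eigenfunction property of [cos (l x)] for [T]: as [cos (l pi / 2) = 0] and
    [sin (l pi / 2) = 1], one has [sin (l (pi / 2 - w)) = cos (l w)]. *)
Lemma integral_kernel_sum {R : realType} n N (w a : R) : 0 <= w <= pi / 2 ->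
  (\int[lebesgue_measure]_(x in `]0%R, (pi / 2 - w)%R[) (kernel_sum n N x a)%:E
    = (kernel_sum n.+1 N w a)%:E)%E.
Proof.
move=> /andP[w0 wpi].
rewrite (integral_oo_derive _ (is_derive_kernel_sum n N a)) ?subr_ge0//; last first.
  exact: continuous_kernel_sum.
rewrite -mulrBr -sumrB; congr (_ * _)%:E; apply: eq_bigr => j _.
rewrite mulr0 sin0 !mul0r subr0 mulrBr sinB cos_freq_pihalf sin_freq_pihalf.
by rewrite mul0r mul1r subr0.
Qed.

(** Each [cos (l x) ^ 2] has integral [pi / 4], which the factor [4 / pi] normalizes; this is the
    truncated trace. *)
Lemma integral_kernel_sum_diag {R : realType} n N :
  (\int[lebesgue_measure]_(x in `]0%R, (pi / 2)%R[) (kernel_sum n N x x)%:E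
    = (\sum_(j < N) (freq j : R)^-1 ^+ n)%:E)%E.
Proof.
have pi0 := @pi_gt0 R.
rewrite (integral_oo_derive _ (is_derive_kernel_sum_diag n N)); last 2 first.
- by rewrite divr_ge0 ?ltW.
- exact: continuous_kernel_sum_diag.
rewrite -mulrBr -sumrB mulr_sumr; congr (_%:E); apply: eq_bigr => j _.
rewrite mulr0 sin0 !mul0r addr0 !mul0r subr0.
rewrite (_ : 2 * freq j * (pi / 2) = (freq j * (pi / 2)) *+ 2); last first.
  by rewrite mulr2n; ring.
rewrite sin_mulr2n cos_freq_pihalf mul0r mul0rn mul0r addr0 exprVn.
have := lt0r_neq0 pi0; have := expf_neq0 n (@freq_neq0 R j).
by move: (pi : R) (freq j ^+ n) => p m m0 p0; field; rewrite m0.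
Qed.

(** A constant is integrable on a bounded interval. Measurability of [f] follows from the pointwise
    convergence, so none has to be shown for [chain_volume]; integrability of [f] will give the
    finiteness of the volume. *)
Lemma dominated_convergence_oo {R : realType} (b C : R) (f_ : nat -> R -> R)
    (f : R -> \bar R) :
  (forall N, continuous (f_ N)) -> (forall N x, `|f_ N x| <= C) ->
  (forall x, 0 < x < b -> (f_ N x)%:E @[N --> \oo] --> f x) ->
  lebesgue_measure.-integrable `]0, b[ f /\
  (\int[lebesgue_measure]_(x in `]0%R, b[) (f_ N x)%:E @[N --> \oo] -->
     \int[lebesgue_measure]_(x in `]0%R, b[) f x)%E.
Proof.
move=> cf_ f_C f_f.
have mf_ N : measurable_fun `]0, b[ (EFin \o f_ N).
  apply/measurable_EFinP.
  by apply: measurable_funS (continuous_measurable_fun (cf_ N)).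
have f_f' x : `]0, b[%classic x -> (EFin \o f_ N) x @[N --> \oo] --> f x.
  by rewrite /= in_itv/= => /f_f.
have [] // := @dominated_convergence _ _ R lebesgue_measure `]0, b[ _
  (fun N => EFin \o f_ N) f (cst C%:E).
- exact: emeasurable_fun_cvg f_f'.
- exact: aeW.
- apply/integrableP; split; first exact: measurable_cst.
  rewrite integral_cst//= lebesgue_measure_itv/=.
  by case: ifP => _; rewrite ?mule0 -?EFinB -?EFinM ltry.
- by apply: aeW => x N _; rewrite /= lee_fin.
Qed.

(** * The volume as an iterated integral of the kernels *)

(* [chain m a w u]: the inequalities of [Pi_poly] along the path
   [a, u 0, ..., u (m - 1), w]. *)
Fixpoint chain {R : realType} (m : nat) (a w : R) (u : nat -> R) : bool :=
  match m with
  | 0 => a + w < pi / 2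
  | k.+1 => [&& 0 < u k, u k + w < pi / 2 & chain k a (u k) u]
  end.

(** As a function of [a] and [w], the kernel of [T ^ (m + 1)]. *)
Definition chain_volume {R : realType} (m : nat) (a w : R) : \bar R :=
  iter_lebesgue_int m (fun u => (chain m a w u)%:R%:E).

Lemma eq_chain {R : realType} m (a w : R) (u v : nat -> R) :
  (forall i, (i < m)%N -> u i = v i) -> chain m a w u = chain m a w v.
Proof.
elim: m w => //= m IH w uv; rewrite uv// IH// => i im.
by rewrite uv// ltnS ltnW.
Qed.

Lemma chainP {R : realType} m (a w : R) (u : nat -> R) :
  chain m.+1 a w u <-> a + u 0%N < pi / 2 /\
    forall i, (i <= m)%N ->
      0 < u i /\ u i + (if i == m then w else u i.+1) < pi / 2.
Proof.
elim: m w => [|m IH] w.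
  rewrite /=; split=> [/and3P[? ? ?]|[? /(_ 0%N isT)[? ?]]]; last exact/and3P.
  by split=> // i; rewrite leqn0 => /eqP->.
split.
  move=> /and3P[um1 um1w /IH[au0 uP]]; split=> // i.
  rewrite leq_eqVlt => /predU1P[->|]; first by rewrite eqxx.
  rewrite ltnS => im; rewrite ltn_eqF ?ltnS//.
  have := uP i im; case: eqVneq => [->//|//].
move=> [au0 uP]; apply/and3P; have [um1 um1w] := uP m.+1 (leqnn _).
split=> //; first by rewrite eqxx in um1w.
apply/IH; split=> // i im; have := uP i (leqW im).
rewrite (ltn_eqF (_ : i < m.+1)%N)//; case: eqVneq => [->//|//].
Qed.

Lemma iter_lebesgue_int_eq0 {R : realType} m (F : (nat -> R) -> \bar R) :
  (forall u, F u = 0%E) -> iter_lebesgue_int m F = 0%E.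
Proof.
elim: m F => [|m IH] F F0; first exact: F0.
by apply: integral0_eq => x _; apply: IH => u; exact: F0.
Qed.

(** The outermost variable [u m] is the neighbour of [w]: its two inequalities give the interval,
    and the remaining ones form a chain ending at [u m]. *)
Lemma chain_volumeS {R : realType} m (a w : R) :
  chain_volume m.+1 a w =
  (\int[lebesgue_measure]_(x in `]0%R, (pi / 2 - w)%R[) chain_volume m a x)%E.
Proof.
rewrite [RHS]integral_mkcond; apply: eq_integral => x _.
rewrite patchE mem_setE in_itv/= ltrBrDr; case: ifPn => xw.
  rewrite /chain_volume; congr iter_lebesgue_int; apply/funext => u /=.
  rewrite eqxx andbA xw/=; congr (_%:R%:E); congr nat_of_bool.
  by apply: eq_chain => i im; rewrite ltn_eqF.
by apply: iter_lebesgue_int_eq0 => u /=; rewrite eqxx andbA (negbTE xw).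
Qed.

(** The cycle is cut at its last coordinate, which becomes both ends of the path. *)
Lemma Pi_poly_chain {R : realType} m (u : nat -> R) :
  Pi_poly m.+2 u <-> 0 < u m.+1 /\ chain m.+1 (u m.+1) (u m.+1) u.
Proof.
split.
  move=> uP; split; first by have [] := uP m.+1 (ltnSn _).
  apply/chainP; split; first by have [_] := uP m.+1 (ltnSn _); rewrite modnn.
  move=> i im; have := uP i (leqW im).
  by rewrite modn_small ?ltnS//; case: eqVneq => [->|].
move=> [um1 /chainP[u0 uP]] i; rewrite ltnS leq_eqVlt => /predU1P[->|].
  by rewrite modnn.
rewrite ltnS => im; have := uP i im.
by rewrite modn_small ?ltnS//; case: eqVneq => [->|].
Qed.

Lemma volume_Pi_poly {R : realType} m :
  volume m.+2 (@Pi_poly R m.+2) =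
  (\int[lebesgue_measure]_(a in `]0%R, (pi / 2)%R[) chain_volume m.+1 a a)%E.
Proof.
rewrite [RHS]integral_mkcond; apply: eq_integral => x _.
pose upd u i : R := if i == m.+1 then x else u i.
have updP u : Pi_poly m.+2 (upd u) <-> 0 < x /\ chain m.+1 x x u.
  rewrite Pi_poly_chain {1 2 3}/upd eqxx; split=> -[x0 xu]; split=> //.
    by rewrite (@eq_chain _ _ _ _ _ (upd u))// => i im; rewrite /upd ltn_eqF.
  by rewrite (@eq_chain _ _ _ _ _ u)// => i im; rewrite /upd ltn_eqF.
rewrite patchE mem_setE in_itv/=.
rewrite -[LHS]/(iter_lebesgue_int m.+1 (fun u => (\1_(Pi_poly m.+2) (upd u))%:E)).
case: ifPn => xpi.
  apply: (congr1 (@iter_lebesgue_int R m.+1)); apply/funext => u.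
  rewrite indicE; congr (_%:R%:E); congr nat_of_bool.
  apply/idP/idP; first by rewrite inE => /updP[].
  by move=> xu; rewrite inE; apply/updP; split=> //; case/andP: xpi.
(* For [x] outside []0, pi / 2[] no point of the polytope exists: [u m > 0] and [u m + x < pi / 2]
   force [x < pi / 2]. *)
apply: iter_lebesgue_int_eq0 => u; rewrite indicE memNset//.
move=> /updP[x0 /and3P[um umx _]]; move: xpi; rewrite x0/= -leNgt => xpi.
by move: um umx; lra.
Qed.

(** The conditions [x + w < pi / 2] and [a + x < pi / 2] merge into [x < pi / 2 - max w a]. *)
Lemma chain_volume1 {R : realType} (a w : R) : 0 < a < pi / 2 -> 0 < w < pi / 2 ->
  chain_volume 1 a w = (pi / 2 - Num.max w a)%:E.
Proof.
move=> /andP[a0 api] /andP[w0 wpi].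
transitivity (\int[lebesgue_measure]_(x in `]0%R, (pi / 2 - Num.max w a)%R[)
  (cst 1 x : \bar R))%E.
  rewrite chain_volumeS integral_mkcond [RHS]integral_mkcond.
  apply: eq_integral => x _; rewrite !patchE !mem_setE !in_itv/=.
  rewrite /chain_volume/= !ltrBrDr addr_maxr gt_max [x + a]addrC.
  by case: (0 < x); case: (x + w < _); case: (a + x < _).
rewrite integral_cst//= mul1e lebesgue_measure_itv/= lte_fin subr_gt0.
by rewrite gt_max wpi api -EFinB subr0.
Qed.

(** Induction from the kernel of [T ^ 2]: applying [T] raises the exponent in [kernel_sum] by one
    and commutes with the limit by domination. *)
Lemma chain_volume_cvg {R : realType} m (a w : R) :
  0 < a < pi / 2 -> 0 < w < pi / 2 ->
  (kernel_sum m.+2 N w a)%:E @[N --> \oo] --> chain_volume m.+1 a w.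
Proof.
move=> a_itv; elim: m w => [|m IH] w w_itv.
  rewrite chain_volume1//; apply: cvg_EFin; first by near=> N.
  case/andP: a_itv => a0 api; case/andP: w_itv => w0 wpi.
  by apply: kernel_sum2_cvg; rewrite !ltW.
rewrite chain_volumeS.
have w_itv' : 0 <= w <= pi / 2 by case/andP: w_itv => w0 wpi; rewrite !ltW.
under eq_fun do rewrite -integral_kernel_sum//.
apply: (@dominated_convergence_oo _ _ (8 / pi)
  (fun N x => kernel_sum m.+2 N x a) _ _ _ _).2.
- by move=> N; exact: continuous_kernel_sum.
- by move=> N x; exact: kernel_sum_le.
- by move=> x /andP[x0 xw]; apply: IH; rewrite x0/=; lra.
Unshelve. all: by end_near. Qed.

(** * The sum over the integers and the trace formula *)

Lemma sum_S_term {R : realType} n N :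
  \sum_(0 <= m < N) (S_term n m%:Z + S_term n (- m%:Z - 1)) =
  \sum_(j < N.*2) (freq j : R)^-1 ^+ n.
Proof.
elim: N => [|N IH]; first by rewrite big_nil big_ord0.
rewrite big_nat_recr//= IH doubleS !big_ord_recr/= -addrA.
(* [4 N + 1] is the frequency of index [N.*2], and [4 (- N - 1) + 1 = - (4 N + 3)] that of index
   [N.*2.+1]. *)
congr (_ + (_^-1 ^+ n + _^-1 ^+ n)).
  rewrite /freq oddrE -signr_odd odd_double mul1r -muln2 natrM.
  by rewrite rmorphD rmorphM/=; ring.
rewrite /freq oddrE -signr_odd/= odd_double mulN1r
  -[N.*2.+1%:R]natr1 -[N.*2]muln2 natrM.
by rewrite rmorphD rmorphM rmorphB rmorphN/=; ring.
Qed.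

Theorem theorem1 (R : realType) (n : nat) (hn : (2 <= n)%N) :
  volume n (@Pi_poly R n) = (S_sum n : R)%:E.
Proof.
case: n hn => [//|[//|m]] _; rewrite volume_Pi_poly.
set v := (X in X = _).
have pi0 := @pi_gt0 R.
have [] := @dominated_convergence_oo R (pi / 2) (8 / pi)
  (fun N x => kernel_sum m.+2 N x x) (fun a => chain_volume m.+1 a a).
- by move=> N; exact: continuous_kernel_sum_diag.
- by move=> N x; exact: kernel_sum_le.
- by move=> x x_itv; exact: chain_volume_cvg.
(* The volume is finite, so the convergence of the traces can be read in [R]. *)
move=> /integrable_fin_num; rewrite -/v => /(_ (measurable_itv _)) v_fin.
under eq_fun do rewrite integral_kernel_sum_diag.
rewrite -(fineK v_fin).
move=> /fine_cvgP[_ cvg_v]; congr (_%:E); apply/esym/cvg_lim => //.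
under eq_fun do rewrite sum_S_term.
(* Pairing [k = m] with [k = - m - 1] selects the partial sums of even length, a subsequence of the
   traces. *)
apply: (cvg_comp _ _ _ cvg_v).
apply/cvgnyPge => A; exists A => // N /= AN.
by rewrite -addnn (leq_trans AN)// leq_addr.
Qed.
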